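(* Suppose $\boldsymbol{\mathcal X}=\llbracket G_1,\boldsymbol{\mathcal G}_2,\dots,\boldsymbol{\mathcal G}_{d-1},G_d\rrbracket\in\mathbb{R}^{p_1\times\cdots\times p_d}$. Then for $1\le k\le d-1$ the sequential unfolding of $\boldsymbol{\mathcal X}$ can be written as $$\begin{aligned}[\boldsymbol{\mathcal X}]_k=&\,(I_{p_2\cdots p_k}\otimes G_1)(I_{p_3\cdots p_k}\otimes[\boldsymbol{\mathcal G}_2]_2)\cdots(I_{p_k}\otimes[\boldsymbol{\mathcal G}_{k-1}]_2)\,[\boldsymbol{\mathcal G}_k]_2\,[\boldsymbol{\mathcal G}_{k+1}]_1\\&\cdot\bigl([\boldsymbol{\mathcal G}_{k+2}]_1\otimes I_{p_{k+1}}\bigr)\cdots\bigl([\boldsymbol{\mathcal G}_{d-1}]_1\otimes I_{p_{k+1}\cdots p_{d-2}}\bigr)\bigl(G_d^\top\otimes I_{p_{k+1}\cdots p_{d-1}}\bigr).\end{aligned}$$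
   Context: $G_1\in\mathbb{R}^{p_1\times r_1}$, $\boldsymbol{\mathcal G}_k\in\mathbb{R}^{r_{k-1}\times p_k\times r_k}$ ($2\le k\le d-1$), $G_d\in\mathbb{R}^{p_d\times r_{d-1}}$, and $\boldsymbol{\mathcal X}=\llbracket G_1,\boldsymbol{\mathcal G}_2,\dots,\boldsymbol{\mathcal G}_{d-1},G_d\rrbracket$ means $\boldsymbol{\mathcal X}_{i_1,\dots,i_d}=\sum_{\alpha_1=1}^{r_1}\cdots\sum_{\alpha_{d-1}=1}^{r_{d-1}}G_{1,[i_1,\alpha_1]}\boldsymbol{\mathcal G}_{2,[\alpha_1,i_2,\alpha_2]}\cdots\boldsymbol{\mathcal G}_{d-1,[\alpha_{d-2},i_{d-1},\alpha_{d-1}]}G_{d,[i_d,\alpha_{d-1}]}$. Convention $r_0=r_d=1$. For an order-$m$ tensor $\boldsymbol{\mathcal T}\in\mathbb{R}^{q_1\times\cdots\times q_m}$ the sequential unfolding $[\boldsymbol{\mathcal T}]_k\in\mathbb{R}^{(q_1\cdots q_k)\times(q_{k+1}\cdots q_m)}$ has entry $\boldsymbol{\mathcal T}_{i_1,\dots,i_m}$ at row $i_1+(i_2-1)q_1+\cdots+(i_k-1)q_1\cdots q_{k-1}$ and column $i_{k+1}+(i_{k+2}-1)q_{k+1}+\cdots+(i_m-1)q_{k+1}\cdots q_{m-1}$. $U\otimes V$ is the usual Kronecker product, with blocks $U_{ij}V$. At the ends of the train, $[\boldsymbol{\mathcal G}_1]_2$ is read as $G_1$ and $[\boldsymbol{\mathcal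 G}_d]_1$ as $G_d^\top$ (each core appears exactly once in the product): for $k=1$ the product starts with $G_1[\boldsymbol{\mathcal G}_2]_1\cdots$, and for $k=d-1$ it ends with $\cdots[\boldsymbol{\mathcal G}_{d-1}]_2G_d^\top$. *)

(* Defs.v *)
From mathcomp Require Import all_boot all_order all_algebra.
From mathcomp Require Import reals.
From mathcomp.real_closed Require Import mxtens.

Set Implicit Arguments.
Unset Strict Implicit.
Unset Printing Implicit Defensive.

Import GRing.Theory.
Local Open Scope ring_scope.

Definition multi_index (m : nat) (q : nat -> nat) : finType :=
  {dffun forall j : 'I_m, 'I_(q j)}.

(* Modes are numbered from 0: mode j has dimension q j, only q 0, ..., q (m-1)
   matter, and each index i_j runs over 0, ..., q j - 1. *)
Definition tensor (R : Type) (m : nat) (q : nat -> nat) : Type :=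
  {ffun multi_index m q -> R}.

(* With 0-based indices this is
     i_a + i_(a+1) q_a + ... + i_(b-1) q_a ... q_(b-2). *)
Definition position (m : nat) (q : nat -> nat) (a b : nat)
    (i : multi_index m q) : nat :=
  (\sum_(j < m | a <= j < b) i j * \prod_(a <= l < j) q l)%N.

(* For k <= m every pair (a, b) is the position of exactly one multi-index
   (see seq_unfoldE and seq_unfold_index), so the default value 0 is never used. *)
Definition seq_unfold (R : nmodType) (m : nat) (q : nat -> nat)
    (T : tensor R m q) (k : nat) :
    'M[R]_((\prod_(0 <= l < k) q l)%N, (\prod_(k <= l < m) q l)%N) :=
  \matrix_(a, b)
    if [pick i : multi_index m q | (position 0 k i == a) && (position k m i == b)]
      is Some i then T i else 0.

Lemma position_recr (m : nat) (q : nat -> nat) (a b : nat) (hb : (b < m)%N)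
    (i : multi_index m q) : (a <= b)%N ->
  position a b.+1 i = (position a b i +
    i (Ordinal hb) * \prod_(a <= l < b) q l)%N.
Proof.
move=> ab; rewrite /position (bigD1 (Ordinal hb)) /= ?ab ?ltnSn //.
rewrite addnC; congr addn; apply: eq_bigl => j.
by rewrite -val_eqE /= ltnS -andbA [(j <= b)%N && _]andbC -ltn_neqAle.
Qed.

Lemma position_ltn (m : nat) (q : nat -> nat) (a b : nat)
    (i : multi_index m q) : (a <= b <= m)%N ->
  (position a b i < \prod_(a <= l < b) q l)%N.
Proof.
case/andP=> ab; rewrite -(subnKC ab); elim: (b - a)%N => [|s IH] bm.
  rewrite addn0 big_geq // /position big_pred0 // => j.
  by rewrite [(_ <= _)%N]leqNgt andNb.
rewrite addnS in bm *; rewrite position_recr ?leq_addr // big_nat_recr ?leq_addr //=.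
apply: leq_trans (_ : (\prod_(a <= l < a + s) q l *
  (i (Ordinal bm)).+1 <= _)%N); last by rewrite leq_mul2l ltn_ord orbT.
by rewrite mulnS -addSn mulnC leq_add2r IH // ltnW.
Qed.

Lemma position_inj (m : nat) (q : nat -> nat) (a b : nat)
    (i i' : multi_index m q) : (a <= b <= m)%N ->
  position a b i = position a b i' ->
  forall j : 'I_m, (a <= j < b)%N -> i j = i' j.
Proof.
case/andP=> ab; rewrite -(subnKC ab); elim: (b - a)%N => [|s IH] bm.
  by move=> _ j; rewrite addn0 [(_ <= _)%N]leqNgt andNb.
rewrite addnS in bm *; rewrite !position_recr ?leq_addr //.
set P := (\prod_(a <= l < a + s) q l)%N => E.
have lt0 (x : multi_index m q) : (position a (a + s) x < P)%N.
  by apply: position_ltn; rewrite leq_addr ltnW.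
have P0 : (0 < P)%N by apply: leq_ltn_trans (lt0 i).
have /(congr1 (fun x => (x %/ P, x %% P)%N)) := E.
rewrite !(addnC (position _ _ _)) !divnMDl // !modnMDl.
rewrite !divn_small ?lt0 // !modn_small ?lt0 // !addn0 => -[Ei Ep] j.
case/andP=> aj; rewrite ltnS leq_eqVlt => /orP[/eqP js|js].
  have -> : j = Ordinal bm by apply: val_inj.
  exact: val_inj.
by apply: IH => //; rewrite ?aj // ltnW.
Qed.

Lemma seq_unfoldE (R : nmodType) (m : nat) (q : nat -> nat) (T : tensor R m q)
    (k : nat) (i : multi_index m q)
    (a : 'I_(\prod_(0 <= l < k) q l)) (b : 'I_(\prod_(k <= l < m) q l)) :
  (k <= m)%N -> a = position 0 k i :> nat -> b = position k m i :> nat ->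
  seq_unfold T k a b = T i.
Proof.
move=> km Ea Eb; rewrite mxE; case: pickP => [x|/(_ i)]; last first.
  by rewrite Ea Eb !eqxx.
rewrite Ea Eb => /andP[/eqP Ex /eqP Fx]; congr (T _); apply/ffunP => j.
have [jk|kj] := ltnP j k; first by apply: position_inj Ex _ _; rewrite ?km.
by apply: position_inj Fx _ _; rewrite ?km ?leqnn ?kj ?ltn_ord.
Qed.

Lemma seq_unfold_index (m : nat) (q : nat -> nat) (k : nat)
    (a : 'I_(\prod_(0 <= l < k) q l)) (b : 'I_(\prod_(k <= l < m) q l)) :
  (k <= m)%N ->
  exists i : multi_index m q,
    a = position 0 k i :> nat /\ b = position k m i :> nat.
Proof.
move=> km.
have lt1 (i : multi_index m q) : (position 0 k i < \prod_(0 <= l < k) q l)%N.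
  exact: position_ltn.
have lt2 (i : multi_index m q) : (position k m i < \prod_(k <= l < m) q l)%N.
  by apply: position_ltn; rewrite km /=.
pose f i := (Ordinal (lt1 i), Ordinal (lt2 i)).
have f_inj : injective f.
  move=> i i' [E F]; apply/ffunP => j.
  have [jk|kj] := ltnP j k; first by apply: position_inj E _ _; rewrite ?km.
  by apply: position_inj F _ _; rewrite ?km ?leqnn ?kj ?ltn_ord.
have /(inj_card_onto f_inj)/(_ (a, b)) :
    (#|{: 'I_(\prod_(0 <= l < k) q l) * 'I_(\prod_(k <= l < m) q l)}|
     <= #|multi_index m q|)%N.
  rewrite card_prod !card_ord card_dep_ffun -big_cat_nat //=.
  rewrite foldrE big_map big_enum /= big_mkord leq_eqVlt.
  by apply/orP; left; apply/eqP; apply: eq_bigr => j _; rewrite card_ord.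
by case/codomP=> i [Ea Eb]; exists i; rewrite Ea Eb.
Qed.

Definition dims3 (n0 n1 n2 : nat) : nat -> nat := nth 0%N [:: n0; n1; n2].

Definition index3_fun (n0 n1 n2 : nat) (a : 'I_n0) (i : 'I_n1) (b : 'I_n2)
    (j : 'I_3) : 'I_(dims3 n0 n1 n2 j) :=
  let: Ordinal t lt_t3 := j in
  match t return (t < 3)%N -> 'I_(dims3 n0 n1 n2 t) with
  | 0 => fun=> a
  | 1 => fun=> i
  | 2 => fun=> b
  | _ => fun lt_t3 => False_rect _ (notF lt_t3)
  end lt_t3.

Definition index3 (n0 n1 n2 : nat) (a : 'I_n0) (i : 'I_n1) (b : 'I_n2) :
    multi_index 3 (dims3 n0 n1 n2) :=
  [ffun j => index3_fun a i b j].

(* The tensor train [[G_1, G_2, ..., G_(d-1), G_d]] of order d = n.+2.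
   Cores, p and r are numbered from 1; core t.+2 is an
   r_(t.+1) x p_(t.+2) x r_(t.+2) tensor, and only G 2, ..., G (d-1) are used.
   Positions in the multi-indices i and alpha are numbered from 0: i at t is the
   index of mode t.+1, and alpha at t is the index bounded by r_(t.+1). *)
Definition tt_tensor (R : comNzRingType) (n : nat) (p r : nat -> nat)
    (G1 : 'M[R]_(p 1%N, r 1%N))
    (G : forall j : nat, tensor R 3 (dims3 (r j.-1) (p j) (r j)))
    (Gd : 'M[R]_(p n.+2, r n.+1)) : tensor R n.+2 (fun j => p j.+1) :=
  [ffun i : multi_index n.+2 (fun j => p j.+1) =>
    \sum_(alpha : multi_index n.+1 (fun j => r j.+1))
      (G1 (i ord0) (alpha ord0) *
       (\prod_(t < n)
          G t.+2 (index3 (alpha (widen_ord (leqnSn n) t))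
                         (i (lift ord0 (widen_ord (leqnSn n) t)))
                         (alpha (lift ord0 t)))) *
       Gd (i ord_max) (alpha ord_max))].

(* Matrices packed with their dimensions, so that products of long chains need
   no casts; a product is None when consecutive dimensions do not match. *)
Record packed_mx (R : Type) : Type :=
  PackMx { nrows : nat; ncols : nat; unpack : 'M[R]_(nrows, ncols) }.

Definition packed_mul (R : pzRingType) (A B : packed_mx R) :
    option (packed_mx R) :=
  if @eqP _ (nrows B) (ncols A) is ReflectT e
  then Some (PackMx (unpack A *m castmx (e, erefl) (unpack B)))
  else None.

Fixpoint packed_prod (R : pzRingType) (s : seq (packed_mx R)) :
    option (packed_mx R) :=
  match s with
  | [::] => None
  | [:: A] => Some A
  | A :: s' => obind (packed_mul A) (packed_prod s')
  end.

(* tensmx A B is the Kronecker product with blocks A i j *: B. *)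
Definition packed_kron (R : pzRingType) (A B : packed_mx R) : packed_mx R :=
  PackMx (tensmx (unpack A) (unpack B)).

Definition packed_id (R : pzRingType) (m : nat) : packed_mx R :=
  PackMx (1%:M : 'M[R]_m).

(* The end cores are matrices: [G_1]_2 stands for G_1. *)
Definition core_unfold2 (R : comNzRingType) (p r : nat -> nat)
    (G1 : 'M[R]_(p 1%N, r 1%N))
    (G : forall j : nat, tensor R 3 (dims3 (r j.-1) (p j) (r j)))
    (j : nat) : packed_mx R :=
  if j == 1%N then PackMx G1 else PackMx (seq_unfold (G j) 2).

(* Likewise [G_d]_1, with d = n.+2, stands for the transpose of G_d. *)
Definition core_unfold1 (R : comNzRingType) (n : nat) (p r : nat -> nat)
    (G : forall j : nat, tensor R 3 (dims3 (r j.-1) (p j) (r j)))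
    (Gd : 'M[R]_(p n.+2, r n.+1)) (j : nat) : packed_mx R :=
  if j == n.+2 then PackMx Gd^T else PackMx (seq_unfold (G j) 1).

(* Main.v *)
Require Import Defs.
From mathcomp Require Import all_boot all_order all_algebra.
From mathcomp Require Import reals.
From mathcomp.real_closed Require Import mxtens.

Set Implicit Arguments.
Unset Strict Implicit.
Unset Printing Implicit Defensive.

Import GRing.Theory.
Local Open Scope ring_scope.

(** Multiplying the chain from the right, every partial product can be written
    down entry by entry.  Write [core j a i b] for the entries of the j-th core,
    and let [train c j a i] be the contraction of the cores j, ..., j + c with
    the left bond index a held fixed and the other bond indices summed; it
    satisfies
      train (c+1) j a i = \sum_b core j a i_j b * train c (j+1) b i.
    Let y be a column number of the unfolding; its mixed-radix digits in the
    radices p_(k+1), p_(k+2), ... are the mode indices i_(k+1), ..., i_d.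

    For j > k, a row of the product of the factors j, ..., d consists of a bond
    index a and of a number encoding i_(k+1), ..., i_(j-1).  The identity factor
    of each Kronecker product carries this number along, so the entry is
    train (d-j) j a (digits of y) if the number agrees with the low digits of y,
    and 0 otherwise ([packed_prod_row_cores]).  For j = k+1 nothing is left to be
    compared.  Continuing to the left, the identity factor of the j-th Kronecker
    product carries the digits i_(j+1), ..., i_k of the row, which the later
    factors consume one at a time; the entry of the product of the factors
    j, ..., d is train (d-j) j a i, where i takes its values up to k from the row
    and the others from y ([packed_prod_cores]).  In both cases the Kronecker
    delta in the identity factor reduces the sum over the shared dimension to the
    sum over b in the recursion.

    For j = 1 this is the full contraction, which equals the sum over all bond
    indices defining the tensor train ([train_sum], [tt_tensorE]).  The digits of
    the row and column number of an entry are its mode indices because a position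
    is a mixed-radix numeral ([digit_position]). *)

(** * Matrices given by functions of natural numbers *)

(** Entries indexed by natural numbers remove the casts between equal dimensions:
    two such matrices agree as soon as the dimensions are equal and the functions
    agree within range, and Kronecker products become division with remainder. *)
Definition fun_mx (R : Type) (m n : nat) (f : nat -> nat -> R) : packed_mx R :=
  PackMx (\matrix_(i < m, j < n) f i j).

Definition entry (R : nmodType) (m n : nat) (A : 'M[R]_(m, n)) (x y : nat) : R :=
  if insub x is Some i then if insub y is Some j then A i j else 0 else 0.

Lemma entry_ord (R : nmodType) (m n : nat) (A : 'M[R]_(m, n)) (i : 'I_m) (j : 'I_n) :
  entry A i j = A i j.
Proof. by rewrite /entry !valK. Qed.

Lemma eq_fun_mx (R : Type) (m m' n n' : nat) (f f' : nat -> nat -> R) :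
  m = m' -> n = n' ->
  (forall x y, (x < m)%N -> (y < n)%N -> f x y = f' x y) ->
  fun_mx m n f = fun_mx m' n' f'.
Proof.
move=> <- <- eq_f; congr PackMx; apply/matrixP => i j.
by rewrite !mxE eq_f.
Qed.

Lemma pack_fun_mx (R : nmodType) (m n m' n' : nat) (A : 'M[R]_(m, n))
    (f : nat -> nat -> R) :
  m = m' -> n = n' -> (forall i j, A i j = f i j) -> PackMx A = fun_mx m' n' f.
Proof.
by move=> <- <- eq_A; congr PackMx; apply/matrixP => i j; rewrite mxE eq_A.
Qed.

Lemma packed_id_fun_mx (R : pzRingType) (m : nat) :
  packed_id R m = fun_mx m m (fun x y => (x == y)%:R).
Proof. by apply: pack_fun_mx => // i j; rewrite mxE. Qed.

Lemma packed_mul_fun_mx (R : pzRingType) (m n n' l : nat)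
    (f g : nat -> nat -> R) :
  n' = n ->
  packed_mul (fun_mx m n f) (fun_mx n' l g) =
    Some (fun_mx m l (fun x y => \sum_(z < n) f x z * g z y)).
Proof.
move=> en; case: n / en; rewrite /packed_mul; case: eqP => //= e.
congr Some; apply: pack_fun_mx => // i j.
rewrite mxE; apply: eq_bigr => z _.
by rewrite castmxE !mxE.
Qed.

Lemma packed_kron_fun_mx (R : pzRingType) (m n m' n' : nat)
    (f g : nat -> nat -> R) :
  packed_kron (fun_mx m n f) (fun_mx m' n' g) =
    fun_mx (m * m') (n * n')
      (fun x y => f (x %/ m')%N (y %/ n')%N * g (x %% m')%N (y %% n')%N).
Proof. by apply: pack_fun_mx => // i j; rewrite !mxE. Qed.

Lemma packed_prod_cons (R : pzRingType) (A B : packed_mx R) (s : seq (packed_mx R)) :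
  packed_prod s = Some B -> packed_prod (A :: s) = packed_mul A B.
Proof. by case: s => // C s /= ->. Qed.

(** * Sums along residue classes *)

Lemma sum_ord_mul (R : nmodType) (m n : nat) (F : nat -> R) :
  \sum_(z < m * n) F z = \sum_(x < m) \sum_(y < n) F (x * n + y)%N.
Proof.
rewrite pair_bigA /= (reindex (@mxtens_index m n)) //=.
by exists (@mxtens_unindex m n) => z _; rewrite ?mxtens_indexK ?mxtens_unindexK.
Qed.

Lemma sum_ord_delta (R : pzSemiRingType) (m w : nat) (F : nat -> R) : (w < m)%N ->
  \sum_(z < m) (z == w :> nat)%:R * F z = F w.
Proof.
move=> lt_wm; rewrite (bigD1 (Ordinal lt_wm)) //= eqxx mul1r big1 ?addr0 // => z.
by rewrite -val_eqE /= => /negPf ->; rewrite mul0r.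
Qed.

(** The summation step for a factor B (x) I: the identity fixes the remainder of
    the summation index, so only its quotient is summed. *)
Lemma sum_modn_delta (R : pzSemiRingType) (m n w : nat) (F : nat -> R) : (w < n)%N ->
  \sum_(z < m * n) (z %% n == w)%N%:R * F z = \sum_(x < m) F (x * n + w)%N.
Proof.
move=> lt_wn.
rewrite (sum_ord_mul _ _ (fun z => (z %% n == w)%N%:R * F z)).
apply: eq_bigr => x _.
rewrite -[RHS](sum_ord_delta (fun y => F (x * n + y)%N) lt_wn).
by apply: eq_bigr => y _; rewrite modnMDl modn_small.
Qed.

(** The summation step for a factor I (x) B: the identity fixes the quotient of
    the summation index, so only its remainder is summed. *)
Lemma sum_divn_delta (R : pzSemiRingType) (m n w : nat) (F : nat -> R) : (w < m)%N ->
  \sum_(z < m * n) (z %/ n == w)%N%:R * F z = \sum_(y < n) F (w * n + y)%N.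
Proof.
move=> lt_wm.
rewrite (sum_ord_mul _ _ (fun z => (z %/ n == w)%N%:R * F z)).
rewrite -[RHS](sum_ord_delta (fun x => \sum_(y < n) F (x * n + y)%N) lt_wm).
apply: eq_bigr => x _; rewrite mulr_sumr; apply: eq_bigr => y _.
by rewrite divnMDl ?(leq_ltn_trans _ (ltn_ord y)) // divn_small // addn0.
Qed.

(** * Mixed-radix digits *)

(** The digit of x of weight p_s ... p_(l-1) in the mixed radix p_s, p_(s+1), ... *)
Definition digit (p : nat -> nat) (s x l : nat) : nat :=
  (x %/ \prod_(s <= t < l) p t %% p l)%N.

Lemma digitS (p : nat -> nat) (s x l : nat) : (s < l)%N ->
  digit p s x l = digit p s.+1 (x %/ p s) l.
Proof. by move=> lt_sl; rewrite /digit big_ltn // divnMA. Qed.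

Lemma digit_id (p : nat -> nat) (s x : nat) : digit p s x s = (x %% p s)%N.
Proof. by rewrite /digit big_geq // divn1. Qed.

(** Of the terms of the position, those before c add up to less than the weight
    of c, and those after c are multiples of that weight times q_c; so division
    by the weight followed by reduction modulo q_c leaves only i_c. *)
Lemma digit_position (m : nat) (q : nat -> nat) (a b : nat)
    (i : multi_index m q) (c : 'I_m) : (a <= c < b)%N -> (b <= m)%N ->
  digit q a (position a b i) c = i c.
Proof.
case/andP=> ac; elim: b => // b IH; rewrite ltnS leq_eqVlt => /orP[/eqP cb|cb] bm.
  have ab : (a <= b)%N by rewrite -cb.
  have Ec : Ordinal bm = c by apply: val_inj.
  rewrite position_recr // Ec -cb /digit.
  have lt : (position a c i < \prod_(a <= l < c) q l)%N.
    by apply: position_ltn; rewrite ac cb ltnW.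
  rewrite addnC divnMDl ?(leq_ltn_trans _ lt) // divn_small // addn0.
  by rewrite modn_small.
rewrite position_recr ?(leq_trans ac (ltnW cb)) //.
rewrite -[RHS](IH cb (ltnW bm)) /digit.
rewrite (big_cat_nat ac (ltnW cb)) /= (big_ltn cb).
set P := (\prod_(a <= l < c) q l)%N.
have P0 : (0 < P)%N.
  apply: leq_ltn_trans (_ : position a c i < P)%N => //.
  by apply: position_ltn; rewrite ac ltnW // ltn_ord.
set Z := (\prod_(c.+1 <= l < b) q l)%N.
have -> : (i (Ordinal bm) * (P * (q c * Z)) = i (Ordinal bm) * Z * q c * P)%N.
  by rewrite mulnCA [RHS]mulnC -mulnA [(q c * Z)%N]mulnC.
by rewrite addnC divnMDl // modnMDl.
Qed.

(** * Trains of cores with natural-number indices *)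

Section Train.

Variables (R : comNzRingType) (p r : nat -> nat).
Variable g : nat -> nat -> nat -> nat -> R.

(** [c] counts the bonds still to be summed, so that [train c j] contracts the
    cores j, ..., j + c.  The last core has no bond on its right, and is read at
    the bond index 0. *)
Fixpoint train (c j a : nat) (i : nat -> nat) : R :=
  if c is c'.+1 then \sum_(b < r j) g j a (i j) b * train c' j.+1 b i
  else g j a (i j) 0%N.

Lemma eq_train (c j a : nat) (i i' : nat -> nat) :
  (forall l, (j <= l <= j + c)%N -> i l = i' l) -> train c j a i = train c j a i'.
Proof.
elim: c j a => [|c IH] j a eq_i /=; first by rewrite eq_i // addn0 leqnn.
apply: eq_bigr => b _; rewrite eq_i ?leqnn ?leq_addr //; congr (_ * _).
by apply: IH => l /andP[jl lc]; apply: eq_i; rewrite ltnW //= addnS.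
Qed.

(** The unfolding [G_j]_1, whose column number is i_j + b p_j. *)
Definition row_core (j : nat) : packed_mx R :=
  fun_mx (r j.-1) (p j * r j) (fun a y => g j a (y %% p j)%N (y %/ p j)%N).

(** The unfolding [G_j]_2, whose row number is a + i_j r_(j-1). *)
Definition col_core (j : nat) : packed_mx R :=
  fun_mx (r j.-1 * p j) (r j) (fun x b => g j (x %% r j.-1)%N (x %/ r j.-1)%N b).

Variables (k d : nat).
Hypothesis lt_kd : (k < d)%N.
Hypothesis r_d : r d = 1%N.

(** A row number x of the product of the factors j, ..., d is a P + x mod P, where
    a is a bond index and x mod P, for P = p_(k+1) ... p_(j-1), encodes
    i_(k+1), ..., i_(j-1).  The factor j compares x mod P with the lowest digits
    of z mod (P p_j), the factors to its right compare z mod (P p_j) with the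
    digits of y; hence z mod (P p_j) is determined by y, and the sum over z
    reduces to the bond index z / (P p_j). *)
Lemma packed_prod_row_cores (c j : nat) : (k < j)%N -> (j + c)%N = d ->
  packed_prod [seq packed_kron (row_core l) (packed_id R (\prod_(k.+1 <= i < l) p i)%N)
                 | l <- iota j c.+1]
  = Some (fun_mx (r j.-1 * \prod_(k.+1 <= i < j) p i) (\prod_(k.+1 <= i < d.+1) p i)
      (fun x y => let P := (\prod_(k.+1 <= i < j) p i)%N in
         (x %% P == y %% P)%N%:R * train c j (x %/ P)%N (digit p k.+1 y))).
Proof.
elim: c j => [|c IH] j lt_kj.
  rewrite addn0 => jd; rewrite /= packed_id_fun_mx packed_kron_fun_mx.
  have eqP : (\prod_(k.+1 <= i < d.+1) p i = p j * r j * \prod_(k.+1 <= i < j) p i)%N.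
    by rewrite jd r_d muln1 big_nat_recr // mulnC.
  congr Some; apply: eq_fun_mx => // x y lt_x lt_y /=.
  set P := (\prod_(k.+1 <= i < j) p i)%N in lt_x lt_y *.
  have lt_yP : (y %/ P < p j)%N.
    move: lt_y; rewrite jd r_d muln1; case: (P) => [|P' lt_y].
      by rewrite muln0.
    by rewrite ltn_divLR.
  by rewrite mulrC /digit -/P (divn_small lt_yP).
rewrite addnS => jd; rewrite [iota _ _]/= map_cons.
have {}IH := IH j.+1 (ltnW lt_kj) jd.
rewrite (packed_prod_cons _ IH) packed_id_fun_mx packed_kron_fun_mx.
have le_jd : (j <= d)%N by rewrite -jd leqW // leq_addr.
have PS : (\prod_(k.+1 <= i < j.+1) p i = p j * \prod_(k.+1 <= i < j) p i)%N.
  by rewrite big_nat_recr // mulnC.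
rewrite packed_mul_fun_mx; last by rewrite /= PS mulnA [(p j * _)%N]mulnC.
congr Some; apply: eq_fun_mx => // x y lt_x lt_y /=.
rewrite PS; set P := (\prod_(k.+1 <= i < j) p i)%N in lt_x lt_y *.
have lt_yP : (y %% (p j * P) < p j * P)%N.
  rewrite ltn_mod lt0n; apply/eqP => P0; move: lt_y.
  by rewrite (@big_cat_nat _ _ _ j.+1) ?PS ?P0 //= ltnW.
pose F z := g j (x %/ P) (z %/ P %% p j) (z %/ P %/ p j) * (x %% P == z %% P)%N%:R
   * train c j.+1 (z %/ (p j * P)) (digit p k.+1 y).
transitivity (\sum_(z < r j * (p j * P)) (z %% (p j * P) == y %% (p j * P))%N%:R * F z).
  rewrite mulnA [(r j * _)%N]mulnC; apply: eq_bigr => z _.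
  by rewrite mulrCA /F !mulrA.
rewrite sum_modn_delta // mulr_sumr; apply: eq_bigr => b _.
have ltp : (0 < p j * P)%N := leq_ltn_trans (leq0n _) lt_yP.
have ltP : (0 < P)%N by move: ltp; rewrite muln_gt0 => /andP[].
have ltpj : (0 < p j)%N by move: ltp; rewrite muln_gt0 => /andP[].
(* The intermediate index z, split by the column numbering of factor j. *)
have Ediv : (b * (p j * P) + y %% (p j * P) = (b * p j + y %/ P %% p j) * P + y %% P)%N.
  rewrite {1}(divn_eq (y %% (p j * P)) P) -modn_divl modn_dvdm ?dvdn_mull //.
  by rewrite mulnDl mulnA addnA.
rewrite /F divnMDl // [(y %% _ %/ _)%N]divn_small // addn0 Ediv divnMDl //.
rewrite modnMDl modn_mod [(y %% P %/ P)%N]divn_small ?ltn_mod // addn0.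
rewrite modnMDl modn_mod divnMDl // [(y %/ P %% p j %/ p j)%N]divn_small ?ltn_mod // addn0.
by rewrite -/(digit p k.+1 y j) mulrA [in RHS](mulrC _%:R).
Qed.

(** The mode indices j, j+1, ... read from a row number x, which encodes those up
    to k, and a column number y, which encodes those from k+1 on. *)
Let position_digits (j x y l : nat) : nat :=
  if (l <= k)%N then digit p j x l else digit p k.+1 y l.

(** A row number of the product of the factors j, ..., d is a + r_(j-1) x, where
    x encodes i_j, ..., i_k.  The identity in the factor j forwards x / p_j, which
    encodes i_(j+1), ..., i_k, while the core itself consumes the digit i_j. *)
Lemma packed_prod_cores (m j : nat) : (0 < j)%N -> (j + m)%N = k.+1 ->
  packed_prod
    ([seq packed_kron (packed_id R (\prod_(l.+1 <= i < k.+1) p i)%N) (col_core l)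
       | l <- iota j m] ++
     [seq packed_kron (row_core l) (packed_id R (\prod_(k.+1 <= i < l) p i)%N)
       | l <- iota k.+1 (d - k)])
  = Some (fun_mx (r j.-1 * \prod_(j <= i < k.+1) p i) (\prod_(k.+1 <= i < d.+1) p i)
      (fun x y => train (d - j) j (x %% r j.-1)
                    (position_digits j (x %/ r j.-1) y))).
Proof.
elim: m j => [|m IH] j j0.
  (* For j = k+1, P is an empty product: the delta compares numbers modulo 1. *)
  rewrite addn0 => ->; rewrite [iota _ 0]/= cat0s.
  have dk : (d - k = (d - k.+1).+1)%N by rewrite subnSK.
  rewrite dk packed_prod_row_cores ?subnKC //=.
  congr Some; apply: eq_fun_mx => //; rewrite big_geq // muln1 => x y lt_x _ /=.
  rewrite !modn1 divn1 mul1r modn_small //; apply: eq_train => l /andP[kl _].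
  by rewrite /position_digits leqNgt kl.
rewrite addnS => jk; rewrite map_cons cat_cons.
have {}IH := IH j.+1 isT jk.
have le_jk : (j <= k)%N by rewrite -ltnS -jk ltnS leq_addr.
rewrite (packed_prod_cons _ IH) packed_id_fun_mx packed_kron_fun_mx.
rewrite packed_mul_fun_mx; last by rewrite mulnC.
have Pj : (\prod_(j <= i < k.+1) p i = p j * \prod_(j.+1 <= i < k.+1) p i)%N.
  by rewrite big_ltn // ltnS.
congr Some; apply: eq_fun_mx => //; first by rewrite Pj mulnC -mulnA.
rewrite /=; set P := (\prod_(j.+1 <= i < k.+1) p i)%N; set q := r j.-1.
move=> x y lt_x _; have ltP : (x %/ (q * p j) < P)%N.
  by rewrite ltn_divLR //; move: lt_x; case: (q * p j)%N; rewrite ?muln0.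
pose F z := g j (x %% (q * p j) %% q) (x %% (q * p j) %/ q) (z %% r j)
  * train (d - j.+1) j.+1 (z %% r j) (position_digits j.+1 (z %/ r j) y).
transitivity (\sum_(z < P * r j) (z %/ r j == x %/ (q * p j))%N%:R * F z).
  by apply: eq_bigr => z _; rewrite eq_sym mulrA.
rewrite sum_divn_delta //.
have -> : (d - j = (d - j.+1).+1)%N by rewrite subnSK // (leq_ltn_trans le_jk).
rewrite /=; apply: eq_bigr => b _.
have ltr : (0 < r j)%N := leq_ltn_trans (leq0n _) (ltn_ord b).
rewrite /F modnMDl (modn_small (ltn_ord b)) divnMDl // (divn_small (ltn_ord b)) addn0.
rewrite modn_dvdm ?dvdn_mulr // /position_digits le_jk digit_id.
rewrite [(q * p j)%N in X in g _ _ X]mulnC -modn_divl; congr (_ * _).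
apply: eq_train => l /andP[jl _]; rewrite (digitS p (x %/ q)) //.
by rewrite divnMA.
Qed.

End Train.

(** * Summation over bond indices *)

(** As a sequence of numbers, a multi-index has a type free of its dimensions, so
    that removing its first entry is removing the head of a list. *)
Definition index_seq (m : nat) (q : nat -> nat) (i : multi_index m q) : seq nat :=
  [seq i j : nat | j <- enum 'I_m].

Lemma nth_index_seq (m : nat) (q : nat -> nat) (i : multi_index m q) (j : 'I_m) :
  nth 0%N (index_seq i) j = i j.
Proof. by rewrite (nth_map j) ?size_enum_ord ?nth_ord_enum. Qed.

Lemma nth_index_seq_default (m : nat) (q : nat -> nat) (i : multi_index m q) :
  nth 0%N (index_seq i) m = 0%N.
Proof. by rewrite nth_default // size_map size_enum_ord. Qed.

Definition cons_index_fun (m : nat) (q : nat -> nat) (b : 'I_(q 0%N))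
    (i : multi_index m (fun t => q t.+1)) (j : 'I_m.+1) : 'I_(q j) :=
  let: Ordinal t lt_t := j in
  match t return (t < m.+1)%N -> 'I_(q t) with
  | 0 => fun=> b
  | t'.+1 => fun lt_t => i (Ordinal (lt_t : (t' < m)%N))
  end lt_t.

Definition cons_index (m : nat) (q : nat -> nat) (b : 'I_(q 0%N))
    (i : multi_index m (fun t => q t.+1)) : multi_index m.+1 q :=
  [ffun j => cons_index_fun b i j].

Lemma index_seq_cons (m : nat) (q : nat -> nat) (b : 'I_(q 0%N))
    (i : multi_index m (fun t => q t.+1)) :
  index_seq (cons_index b i) = (b : nat) :: index_seq i.
Proof.
rewrite /index_seq enum_ordSl /= ffunE; congr (_ :: _).
rewrite -map_comp; apply: eq_map => j /=; rewrite ffunE /=.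
by congr (nat_of_ord (i _)); apply: val_inj.
Qed.

Lemma sum_multi_index_recl (R : nmodType) (m : nat) (q : nat -> nat)
    (F : multi_index m.+1 q -> R) :
  \sum_i F i = \sum_(b < q 0%N) \sum_(i : multi_index m (fun t => q t.+1))
                 F (cons_index b i).
Proof.
rewrite pair_bigA /= (reindex (fun u => cons_index u.1 u.2)) //=.
pose tail (i : multi_index m.+1 q) : multi_index m (fun t => q t.+1) :=
  [ffun j => i (lift ord0 j)].
exists (fun i : multi_index m.+1 q => (i ord0, tail i)) => [[b i] _|i _] /=.
  congr pair; first by rewrite ffunE.
  apply/ffunP => j; rewrite !ffunE; apply: val_inj => /=.
  by congr (nat_of_ord (i _)); apply: val_inj.
apply/ffunP => -[[|t] lt_t]; rewrite ffunE.
  by rewrite (bool_irrelevance lt_t (ltn0Sn m)).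
rewrite /= ffunE; apply: val_inj.
suff /(congr1 (fun j => i j : nat)) : lift ord0 (Ordinal (lt_t : (t < m)%N)) = Ordinal lt_t by [].
exact: val_inj.
Qed.

(** Distributivity: the nested sums of the recursion are one sum over all bond
    indices.  In the product, the left bond of core j + t is entry t of
    a :: alpha and its right bond is entry t of alpha; for t = c the latter is the
    default value 0, at which [train] reads the last core. *)
Lemma train_sum (R : comNzRingType) (r : nat -> nat)
    (g : nat -> nat -> nat -> nat -> R) (c j a : nat) (i q : nat -> nat) :
  (forall t, (t < c)%N -> q t = r (j + t)%N) ->
  train r g c j a i =
    \sum_(alpha : multi_index c q) \prod_(t < c.+1)
       g (j + t)%N (nth 0%N (a :: index_seq alpha) t) (i (j + t)%N)
         (nth 0%N (index_seq alpha) t).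
Proof.
elim: c j a q => [|c IH] j a q eq_q /=.
  pose e : multi_index 0 q := [ffun t : 'I_0 => match notF (ltn_ord t) with end].
  rewrite (big_pred1 e) => [|x]; last by apply/esym/eqP/ffunP => -[].
  by rewrite big_ord_recl big_ord0 mulr1 addn0 nth_index_seq_default.
transitivity (\sum_(b < q 0%N) g j a (i j) b * train r g c j.+1 b i).
  by rewrite eq_q // addn0.
rewrite sum_multi_index_recl; apply: eq_bigr => b _.
rewrite (IH _ _ (fun t => q t.+1)) => [|t lt_tc]; last by rewrite eq_q ?addSnnS.
rewrite mulr_sumr; apply: eq_bigr => alpha _.
rewrite [RHS]big_ord_recl index_seq_cons /= addn0; congr (_ * _).
by apply: eq_bigr => t _; rewrite /bump /= add1n addSnnS.
Qed.

(** * Cores of a tensor train *)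

Lemma entryE (R : nmodType) (m n : nat) (A : 'M[R]_(m, n)) (x y : nat)
    (i : 'I_m) (j : 'I_n) : i = x :> nat -> j = y :> nat -> entry A x y = A i j.
Proof. by move=> <- <-; rewrite entry_ord. Qed.

Section Index3.

Variables (R : nmodType) (n0 n1 n2 : nat) (T : tensor R 3 (dims3 n0 n1 n2)).

Lemma position_index3 (a : 'I_n0) (i : 'I_n1) (b : 'I_n2) :
  [/\ position 0 1 (index3 a i b) = a,
      position 1 3 (index3 a i b) = (i + b * n1)%N,
      position 0 2 (index3 a i b) = (a + i * n0)%N
    & position 2 3 (index3 a i b) = b].
Proof.
have p0 s : position s s (index3 a i b) = 0%N.
  by rewrite /position big_pred0 // => j; rewrite [(_ <= j)%N]leqNgt andNb.
have e0 (h : (0 < 3)%N) : index3 a i b (Ordinal h) = a :> nat by rewrite ffunE.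
have e1 (h : (1 < 3)%N) : index3 a i b (Ordinal h) = i :> nat by rewrite ffunE.
have e2 (h : (2 < 3)%N) : index3 a i b (Ordinal h) = b :> nat by rewrite ffunE.
split.
- by rewrite (position_recr (isT : 0 < 3)%N) // e0 p0 big_geq // muln1.
- rewrite (position_recr (isT : 2 < 3)%N) // (position_recr (isT : 1 < 3)%N) //.
  by rewrite e1 e2 p0 big_nat1 big_geq // muln1.
- rewrite (position_recr (isT : 1 < 3)%N) // (position_recr (isT : 0 < 3)%N) //.
  by rewrite e0 e1 p0 big_nat1 big_geq // muln1.
- by rewrite (position_recr (isT : 2 < 3)%N) // e2 p0 big_geq // muln1.
Qed.

Lemma prod_dims3 :
  [/\ \prod_(0 <= l < 1) dims3 n0 n1 n2 l = n0,
      \prod_(1 <= l < 3) dims3 n0 n1 n2 l = (n1 * n2)%N,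
      \prod_(0 <= l < 2) dims3 n0 n1 n2 l = (n0 * n1)%N
    & \prod_(2 <= l < 3) dims3 n0 n1 n2 l = n2]%N.
Proof. by split; rewrite ?big_nat1 // big_ltn // big_nat1. Qed.

Lemma seq_unfold1_index3 (a : 'I_n0) (i : 'I_n1) (b : 'I_n2) :
  entry (seq_unfold T 1) a (i + b * n1) = T (index3 a i b).
Proof.
have [Ea Eb _ _] := position_index3 a i b.
have la : (position 0 1 (index3 a i b) < \prod_(0 <= l < 1) dims3 n0 n1 n2 l)%N.
  exact: position_ltn.
have lb : (position 1 3 (index3 a i b) < \prod_(1 <= l < 3) dims3 n0 n1 n2 l)%N.
  exact: position_ltn.
rewrite (entryE _ (i := Ordinal la) (j := Ordinal lb)) //.
exact: seq_unfoldE.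
Qed.

Lemma pack_seq_unfold1 :
  PackMx (seq_unfold T 1) =
    fun_mx n0 (n1 * n2) (fun x y =>
      entry (seq_unfold T 1) x (y %% n1 + y %/ n1 * n1)%N).
Proof.
have [e0 e12 _ _] := prod_dims3.
by apply: pack_fun_mx => // x y; rewrite addnC -divn_eq entry_ord.
Qed.

Lemma pack_seq_unfold2 :
  PackMx (seq_unfold T 2) =
    fun_mx (n0 * n1) n2 (fun x y =>
      entry (seq_unfold T 1) (x %% n0)%N (x %/ n0 + y * n1)%N).
Proof.
have [_ _ e01 e2] := prod_dims3.
apply: pack_fun_mx => // x y.
have lx : (x < n0 * n1)%N by apply: leq_trans (ltn_ord x) _; rewrite e01.
have ly : (y < n2)%N by apply: leq_trans (ltn_ord y) _; rewrite e2.
have n0_gt0 : (0 < n0)%N.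
  by have := leq_ltn_trans (leq0n _) lx; rewrite muln_gt0 => /andP[].
have lx0 : (x %% n0 < n0)%N by rewrite ltn_mod.
have lx1 : (x %/ n0 < n1)%N by rewrite ltn_divLR // mulnC.
rewrite (seq_unfold1_index3 (Ordinal lx0) (Ordinal lx1) (Ordinal ly)).
have [_ _ Ex Ey] := position_index3 (Ordinal lx0) (Ordinal lx1) (Ordinal ly).
by apply: seq_unfoldE; rewrite ?Ex ?Ey //= addnC -divn_eq.
Qed.

End Index3.

Section TensorTrain.

Variables (R : comNzRingType) (n : nat) (p r : nat -> nat).
Variable G1 : 'M[R]_(p 1%N, r 1%N).
Variable G : forall j : nat, tensor R 3 (dims3 (r j.-1) (p j) (r j)).
Variable Gd : 'M[R]_(p n.+2, r n.+1).

(** The convention r_0 = r_d = 1 makes the end cores instances of the general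
    case. *)
Definition bond (j : nat) : nat :=
  if (j == 0%N) || (j == n.+2) then 1%N else r j.

(** The entries of the cores; interior ones are read off the unfolding [G_j]_1,
    whose indices are numbers instead of dependent multi-indices. *)
Definition core (j a i b : nat) : R :=
  if j == 1%N then entry G1 i b
  else if j == n.+2 then entry Gd i a
  else entry (seq_unfold (G j) 1) a (i + b * p j).

Lemma bondE (j : nat) : (0 < j < n.+2)%N -> bond j = r j.
Proof. by case/andP=> j0 jn; rewrite /bond gtn_eqF // ltn_eqF. Qed.

Lemma bond_last : bond n.+2 = 1%N.
Proof. by rewrite /bond eqxx orbT. Qed.

Lemma core_unfold2E (j : nat) : (0 < j < n.+2)%N ->
  core_unfold2 G1 G j = col_core p bond core j.
Proof.
case: j => [|[_|j jn]] //; rewrite /core_unfold2 /col_core.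
  apply: pack_fun_mx; [by rewrite [bond _]/= mul1n | by rewrite bondE |] => i b.
  by rewrite /core /= divn1 entry_ord.
rewrite /= pack_seq_unfold2 !bondE //; last exact: ltnW.
apply: eq_fun_mx => // x y _ _.
by rewrite /core /= ltn_eqF.
Qed.

Lemma core_unfold1E (j : nat) : (1 < j <= n.+2)%N ->
  core_unfold1 G Gd j = row_core p bond core j.
Proof.
case/andP=> j1; rewrite /core_unfold1 /row_core leq_eqVlt => /orP[/eqP ->|jn].
  rewrite eqxx; apply: pack_fun_mx; rewrite ?bond_last ?muln1 ?bondE //= => i b.
  by rewrite mxE /core eqxx /= modn_small // entry_ord.
rewrite ltn_eqF // pack_seq_unfold1 !bondE ?jn ?(ltnW j1) //; last first.
  by case: j j1 jn => [|[|j]] //= _ /ltnW.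
apply: eq_fun_mx => // x y _ _.
by rewrite /core gtn_eqF // ltn_eqF.
Qed.

Lemma tt_tensorE (i : multi_index n.+2 (fun j => p j.+1)) (f : nat -> nat) :
  (forall j : 'I_n.+2, f j.+1 = i j) ->
  tt_tensor G1 G Gd i = train bond core n.+1 1 0 f.
Proof.
move=> eq_f; rewrite ffunE (@train_sum _ _ _ _ _ _ _ (fun t => r t.+1)); last first.
  by move=> t lt_t; rewrite bondE.
apply: eq_bigr => alpha _.
rewrite [RHS]big_ord_recl big_ord_recr /= mulrA; congr (_ * _ * _).
- by rewrite addn0 (eq_f ord0) (nth_index_seq alpha ord0) /core /= entry_ord.
- apply: eq_bigr => t _.
  rewrite -seq_unfold1_index3 -(nth_index_seq alpha (lift ord0 t)).
  rewrite -(nth_index_seq alpha (widen_ord (leqnSn n) t)).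
  rewrite -(eq_f (lift ord0 (widen_ord (leqnSn n) t))).
  by rewrite /= /bump !add1n /core /= !eqSS ltn_eqF.
rewrite /bump /= !add1n (nth_index_seq alpha ord_max) (eq_f ord_max).
by rewrite /core /= eqxx entry_ord.
Qed.

End TensorTrain.

(** * The sequential unfolding of a tensor train *)

Theorem lemma3p1 (R : realType) (n : nat) (p r : nat -> nat)
    (G1 : 'M[R]_(p 1%N, r 1%N))
    (G : forall j : nat, tensor R 3 (dims3 (r j.-1) (p j) (r j)))
    (Gd : 'M[R]_(p n.+2, r n.+1))
    (X : tensor R n.+2 (fun j => p j.+1))
    (hX : X = tt_tensor G1 G Gd)
    (k : nat) (hk : (1 <= k <= n.+1)%N) :
  packed_prod
    ([seq packed_kron (packed_id R (\prod_(j.+1 <= i < k.+1) p i)%N)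
                      (core_unfold2 G1 G j) | j <- index_iota 1 k]
     ++ [:: core_unfold2 G1 G k; core_unfold1 G Gd k.+1]
     ++ [seq packed_kron (core_unfold1 G Gd j)
                         (packed_id R (\prod_(k.+1 <= i < j) p i)%N)
         | j <- index_iota k.+2 n.+3])
  = Some (PackMx (seq_unfold X k)).
Proof.
have [k0 kn] := andP hk; have lt_kd : (k < n.+2)%N by rewrite ltnS.
pose g := core G1 G Gd; pose b := bond n r.
set s := (X in packed_prod X).
have -> : s =
    [seq packed_kron (packed_id R (\prod_(l.+1 <= i < k.+1) p i)%N) (col_core p b g l)
       | l <- iota 1 k] ++
    [seq packed_kron (row_core p b g l) (packed_id R (\prod_(k.+1 <= i < l) p i)%N)
       | l <- iota k.+1 (n.+2 - k)].
  (* The two central factors are Kronecker products with an identity of size 1. *)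
  have -> : iota 1 k = rcons (index_iota 1 k) k.
    by rewrite /index_iota -cats1 -[X in iota 1 X](subnK k0) iotaD subnKC.
  have -> : iota k.+1 (n.+2 - k) = k.+1 :: index_iota k.+2 n.+3.
    by rewrite /index_iota subSn.
  rewrite map_rcons cat_rcons map_cons /s; congr (_ ++ [:: _, _ & _]).
  - apply/eq_in_map => j; rewrite mem_index_iota => /andP[j0 jk].
    by rewrite (core_unfold2E G1 G Gd) // j0 (ltn_trans jk).
  - rewrite (core_unfold2E G1 G Gd) ?k0 // big_geq // packed_id_fun_mx packed_kron_fun_mx.
    apply: eq_fun_mx; rewrite ?mul1n // => x y lt_x lt_y.
    by rewrite (divn_small lt_x) (divn_small lt_y) mul1r (modn_small lt_x) (modn_small lt_y).
  - rewrite (core_unfold1E G1 G Gd) ?ltnS ?k0 // big_geq // packed_id_fun_mx packed_kron_fun_mx.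
    apply: eq_fun_mx; rewrite ?muln1 // => x y _ _.
    by rewrite !divn1 !modn1 mulr1.
  apply/eq_in_map => j; rewrite mem_index_iota => /andP[kj]; rewrite ltnS => jn.
  by rewrite (core_unfold1E G1 G Gd) // jn andbT (leq_trans _ kj).
rewrite (@packed_prod_cores _ _ _ _ _ _ lt_kd (bond_last _ _)) ?add1n //.
congr Some; apply/esym/pack_fun_mx.
- by rewrite mul1n big_add1.
- by rewrite [RHS]big_add1.
(* Modes are numbered from 1 in the train and from 0 in multi-indices. *)
move=> x y; have [i [Ex Ey]] := seq_unfold_index x y (leqW kn).
rewrite (seq_unfoldE _ (leqW kn) Ex Ey) hX modn1 divn1 subn1 /=.
apply: tt_tensorE => j; rewrite Ex Ey.
have digit_succ c z l : digit p c.+1 z l.+1 = digit (fun t => p t.+1) c z l.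
  by rewrite /digit big_add1.
rewrite !digit_succ; case: ltnP => [jk|kj].
  by rewrite digit_position // leqW.
by rewrite digit_position // kj ltn_ord.
Qed.
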